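(* The logic $\mathsf{GS4}$ has the finite model property: for every formula $\varphi$, if $\mathsf{GS4}\nvdash\varphi$, then there is a $\mathsf{GS4}$-model $\mathcal M$ with finitely many worlds such that $\mathcal M\not\models\varphi$.
   Context: Fix a countably infinite set $\mathbb P$ of propositional variables. Formulas: $\varphi,\psi ::= p\mid\bot\mid(\varphi\wedge\psi)\mid(\varphi\vee\psi)\mid(\varphi\to\psi)\mid\Diamond\varphi\mid\Box\varphi$; $\neg\varphi:=\varphi\to\bot$. A bi-intuitionistic frame is $(W,W_\bot,\preccurlyeq,\sqsubseteq)$ with $\preccurlyeq,\sqsubseteq$ preorders on $W$ and $W_\bot\subseteq W$ upward closed under both; infallible if $W_\bot=\varnothing$. A valuation $V:\mathbb P\to 2^W$ has each $V(p)$ upward closed under $\preccurlyeq$ and containing $W_\bot$; a model is $\mathcal M=(W,W_\bot,\preccurlyeq,\sqsubseteq,V)$. Satisfaction: $p$ iff $w\in V(p)$; $\bot$ iff $w\in W_\bot$; $\wedge,\vee$ pointwise; $w\models\varphi\to\psi$ iff for all $v\succcurlyeq w$, $v\models\varphi$ implies $v\models\psi$; $w\models\Diamond\varphi$ iff for all $u\succcurlyeq w$ there is $v\sqsupseteq u$ with $v\models\varphi$; $w\models\Box\varphi$ iff $v\models\varphi$ whenever $w\preccurlyeq u\sqsubseteq v$. $\mathcal M\models\varphi$ iff $\varphi$ holds at every $w\in W\setminus W_\bot$. $\sqsubseteq$ is forward confluent if $w\preccurlyeq w'$ and $w\sqsubseteq v$ imply some $v'$ with $v\preccurlyeq v'$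 and $w'\sqsubseteq v'$; backward confluent if $w\sqsubseteq v\preccurlyeq v'$ implies some $w'$ with $w\preccurlyeq w'\sqsubseteq v'$. The frame is locally linear if $w\preccurlyeq u$ and $w\preccurlyeq v$ imply $u\preccurlyeq v$ or $v\preccurlyeq u$. A $\mathsf{GS4}$-frame is an infallible, locally linear bi-intuitionistic frame in which $\sqsubseteq$ is forward and backward confluent; a $\mathsf{GS4}$-model is a model on such a frame. $\mathsf{CS4}$ is the least set of formulas containing all intuitionistic propositional tautologies and all instances of $\Box(\varphi\to\psi)\to(\Box\varphi\to\Box\psi)$, $\Box(\varphi\to\psi)\to(\Diamond\varphi\to\Diamond\psi)$, $\Box\varphi\to\varphi$, $\varphi\to\Diamond\varphi$, $\Box\varphi\to\Box\Box\varphi$, $\Diamond\Diamond\varphi\to\Diamond\varphi$, closed under modus ponens and necessitation. $\mathsf{GS4}$ is $\mathsf{CS4}$ extended with all instances of $(\Diamond\varphi\to\Box\psi)\to\Box(\varphi\to\psi)$, $\Diamond(\varphi\vee\psi)\to\Diamond\varphi\vee\Diamond\psi$, $\neg\Diamond\bot$, and $(\varphi\to\psi)\vee(\psi\to\varphi)$ (closed under the same rules). *)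

(* Defs.v *)
From mathcomp Require Import all_boot.
Set Implicit Arguments.
Unset Strict Implicit.
Unset Printing Implicit Defensive.

Inductive form : Type :=
| Var : nat -> form
| Bot : form
| And : form -> form -> form
| Or  : form -> form -> form
| Imp : form -> form -> form
| Dia : form -> form
| Box : form -> form.

Definition Neg (a : form) : form := Imp a Bot.

Fixpoint modal_free (a : form) : Prop :=
  match a with
  | Var _ | Bot => True
  | And a b | Or a b | Imp a b => modal_free a /\ modal_free b
  | Dia _ | Box _ => False
  end.

Fixpoint isat (W : Type) (R : W -> W -> Prop) (V : nat -> W -> Prop)
  (w : W) (a : form) : Prop :=
  match a with
  | Var p => V p w
  | Bot => False
  | And a b => isat R V w a /\ isat R V w b
  | Or a b => isat R V w a \/ isat R V w b
  | Imp a b => forall v, R w v -> isat R V v a -> isat R V v b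
  | Dia a => False
  | Box a => False
  end.

Definition is_preorder (W : Type) (R : W -> W -> Prop) : Prop :=
  (forall w, R w w) /\ (forall u v w, R u v -> R v w -> R u w).

Definition ipc_valid (a : form) : Prop :=
  modal_free a /\
  forall (W : Type) (R : W -> W -> Prop) (V : nat -> W -> Prop),
    is_preorder R ->
    (forall p u v, R u v -> V p u -> V p v) ->
    forall w, isat R V w a.

Fixpoint subst (s : nat -> form) (a : form) : form :=
  match a with
  | Var p => s p
  | Bot => Bot
  | And a b => And (subst s a) (subst s b)
  | Or a b => Or (subst s a) (subst s b)
  | Imp a b => Imp (subst s a) (subst s b)
  | Dia a => Dia (subst s a)
  | Box a => Box (subst s a)
  end.

Definition ipc_taut (a : form) : Prop :=
  exists (b : form) (s : nat -> form), ipc_valid b /\ a = subst s b.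

Inductive GS4 : form -> Prop :=
| GS4_taut a : ipc_taut a -> GS4 a
| GS4_K a b : GS4 (Imp (Box (Imp a b)) (Imp (Box a) (Box b)))
| GS4_Kdia a b : GS4 (Imp (Box (Imp a b)) (Imp (Dia a) (Dia b)))
| GS4_T a : GS4 (Imp (Box a) a)
| GS4_Tdia a : GS4 (Imp a (Dia a))
| GS4_4 a : GS4 (Imp (Box a) (Box (Box a)))
| GS4_4dia a : GS4 (Imp (Dia (Dia a)) (Dia a))
| GS4_FS a b : GS4 (Imp (Imp (Dia a) (Box b)) (Box (Imp a b)))
| GS4_DP a b : GS4 (Imp (Dia (Or a b)) (Or (Dia a) (Dia b)))
| GS4_N : GS4 (Neg (Dia Bot))
| GS4_GD a b : GS4 (Or (Imp a b) (Imp b a))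
| GS4_MP a b : GS4 (Imp a b) -> GS4 a -> GS4 b
| GS4_Nec a : GS4 a -> GS4 (Box a).

Record model (W : Type) := Model {
  Wbot : W -> Prop;
  ple : W -> W -> Prop;
  sle : W -> W -> Prop;
  val : nat -> W -> Prop
}.

Definition bi_int_model (W : Type) (M : model W) : Prop :=
  is_preorder (ple M) /\ is_preorder (sle M) /\
  (forall u v, Wbot M u -> ple M u v -> Wbot M v) /\
  (forall u v, Wbot M u -> sle M u v -> Wbot M v) /\
  (forall p u v, ple M u v -> val M p u -> val M p v) /\
  (forall p u, Wbot M u -> val M p u).

Fixpoint sat (W : Type) (M : model W) (w : W) (a : form) : Prop :=
  match a with
  | Var p => val M p w
  | Bot => Wbot M w
  | And a b => sat M w a /\ sat M w b
  | Or a b => sat M w a \/ sat M w b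
  | Imp a b => forall v, ple M w v -> sat M v a -> sat M v b
  | Dia a => forall u, ple M w u -> exists v, sle M u v /\ sat M v a
  | Box a => forall u v, ple M w u -> sle M u v -> sat M v a
  end.

Definition model_valid (W : Type) (M : model W) (a : form) : Prop :=
  forall w, ~ Wbot M w -> sat M w a.

Definition forward_confluent (W : Type) (M : model W) : Prop :=
  forall w w' v, ple M w w' -> sle M w v ->
    exists v', ple M v v' /\ sle M w' v'.

Definition backward_confluent (W : Type) (M : model W) : Prop :=
  forall w v v', sle M w v -> ple M v v' ->
    exists w', ple M w w' /\ sle M w' v'.

Definition locally_linear (W : Type) (M : model W) : Prop :=
  forall w u v, ple M w u -> ple M w v -> ple M u v \/ ple M v u.

Definition infallible (W : Type) (M : model W) : Prop :=
  forall w, ~ Wbot M w.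

Definition GS4_model (W : Type) (M : model W) : Prop :=
  bi_int_model M /\ infallible M /\ locally_linear M /\
  forward_confluent M /\ backward_confluent M.

(* Main.v *)
From HB Require Import structures.
Require Import Defs.
From mathcomp Require Import all_boot.
From mathcomp Require Import boolp classical_sets.
From Stdlib Require Import Relation_Operators.

Set Implicit Arguments.
Unset Strict Implicit.
Unset Printing Implicit Defensive.

(** Prime theories ordered by inclusion form a GS4-model refuting every
    unprovable formula, so it suffices to make GS4-models finite.  For a finite
    set [S] of formulas send a world [w] to the set of all traces [v ∩ S], [v]
    above [w].  By local linearity this set is a chain with least element [w ∩ S],
    and the worlds above [w] have as images exactly the final segments of this
    chain.  Hence equality of images is a bisimulation for [≼], and the finitely
    many images form a GS4-model whose second relation is the reflexive
    transitive closure of the image of [⊑].  Closing under transitivity is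
    harmless: by confluence, the formulas [□a] and [◇a] themselves travel along
    [⊑]. *)

Local Open Scope classical_set_scope.

(** * Deduction from a set of assumptions *)

Definition entails (a b : form) := GS4 (Imp a b).

Lemma GS4_subst_valid (s : seq form) (a : form) :
  ipc_valid a -> GS4 (subst (nth Bot s) a).
Proof. by move=> va; apply: GS4_taut; exists a, (nth Bot s). Qed.

Lemma entails_imp_const a b : entails a (Imp b a).
Proof.
apply: (GS4_subst_valid [:: a; b] (a := Imp (Var 0) (Imp (Var 1) (Var 0)))).
by split=> //= W R V _ mono w v _ va u vu _; exact: mono vu va.
Qed.

Lemma entails_imp_distr a b c :
  entails (Imp a (Imp b c)) (Imp (Imp a b) (Imp a c)).
Proof.
apply: (GS4_subst_valid [:: a; b; c]
  (a := Imp (Imp (Var 0) (Imp (Var 1) (Var 2)))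
          (Imp (Imp (Var 0) (Var 1)) (Imp (Var 0) (Var 2))))).
split=> //= W R V [rR tR] mono w v _ vabc u vu uab t ut ta.
by apply: (vabc t) => //; [exact: tR vu ut | exact: uab].
Qed.

Lemma entails_and_intro a b : entails a (Imp b (And a b)).
Proof.
apply: (GS4_subst_valid [:: a; b]
  (a := Imp (Var 0) (Imp (Var 1) (And (Var 0) (Var 1))))).
by split=> //= W R V _ mono w v _ va u vu ub; split=> //; exact: mono vu va.
Qed.

Lemma and_entails_l a b : entails (And a b) a.
Proof.
apply: (GS4_subst_valid [:: a; b] (a := Imp (And (Var 0) (Var 1)) (Var 0))).
by split=> //= W R V _ mono w v _ [].
Qed.

Lemma and_entails_r a b : entails (And a b) b.
Proof.
apply: (GS4_subst_valid [:: a; b] (a := Imp (And (Var 0) (Var 1)) (Var 1))).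
by split=> //= W R V _ mono w v _ [].
Qed.

Lemma entails_or_l a b : entails a (Or a b).
Proof.
apply: (GS4_subst_valid [:: a; b] (a := Imp (Var 0) (Or (Var 0) (Var 1)))).
by split=> //= W R V _ mono w v _ va; left.
Qed.

Lemma entails_or_r a b : entails b (Or a b).
Proof.
apply: (GS4_subst_valid [:: a; b] (a := Imp (Var 1) (Or (Var 0) (Var 1)))).
by split=> //= W R V _ mono w v _ vb; right.
Qed.

Lemma entails_or_elim a b c :
  entails (Imp a c) (Imp (Imp b c) (Imp (Or a b) c)).
Proof.
apply: (GS4_subst_valid [:: a; b; c]
  (a := Imp (Imp (Var 0) (Var 2))
          (Imp (Imp (Var 1) (Var 2)) (Imp (Or (Var 0) (Var 1)) (Var 2))))).
split=> //= W R V [rR tR] mono w v _ vac u vu ubc t ut [ta|tb].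
- by apply: vac => //; exact: tR vu ut.
- exact: ubc.
Qed.

Lemma bot_entails a : entails Bot a.
Proof.
apply: (GS4_subst_valid [:: a] (a := Imp Bot (Var 0))).
by split=> //= W R V _ _ w v _ [].
Qed.

Lemma entails_refl a : entails a a.
Proof.
apply: (GS4_subst_valid [:: a] (a := Imp (Var 0) (Var 0))).
by split=> //= W R V _ _ w v.
Qed.

Lemma box_entails a b : entails a b -> entails (Box a) (Box b).
Proof. by move=> /GS4_Nec; apply: GS4_MP; exact: GS4_K. Qed.

Lemma dia_entails a b : entails a b -> entails (Dia a) (Dia b).
Proof. by move=> /GS4_Nec; apply: GS4_MP; exact: GS4_Kdia. Qed.

Inductive derives (G : set form) : form -> Prop :=
| derives_thm a : GS4 a -> derives G a
| derives_ax a : G a -> derives G a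
| derives_mp a b : derives G (Imp a b) -> derives G a -> derives G b.

Lemma derives_entails G a b : entails a b -> derives G a -> derives G b.
Proof. by move=> ab; apply: derives_mp; exact: derives_thm. Qed.

Lemma derives_cut (G H : set form) a :
  H `<=` derives G -> derives H a -> derives G a.
Proof.
move=> HG; elim=> {a} [a|a /HG|a b _ ab _ da] //.
- exact: derives_thm.
- exact: derives_mp ab da.
Qed.

Lemma derives_mono (G H : set form) a :
  G `<=` H -> derives G a -> derives H a.
Proof. by move=> GH; apply: derives_cut => b /GH; exact: derives_ax. Qed.

Lemma derives_set0 a : derives set0 a -> GS4 a.
Proof. by elim=> {a} // a b _ ab _; exact: GS4_MP ab. Qed.

Lemma derives_imp G a b : derives (G `|` [set a]) b -> derives G (Imp a b).
Proof.
elim=> {b} [b tb|b [Gb|->]|b c _ abc _ ab].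
- by apply: derives_entails (derives_thm G tb); exact: entails_imp_const.
- by apply: derives_entails (derives_ax Gb); exact: entails_imp_const.
- by apply: derives_thm; exact: entails_refl.
- by apply: derives_mp ab; apply: derives_entails abc; exact: entails_imp_distr.
Qed.

Lemma derives_or_elim G a b c : derives G (Or a b) ->
  derives (G `|` [set a]) c -> derives (G `|` [set b]) c -> derives G c.
Proof.
move=> dab /derives_imp ac /derives_imp bc; apply: derives_mp dab.
by apply: derives_mp bc; apply: derives_entails ac; exact: entails_or_elim.
Qed.

Lemma entails_trans a b c : entails a b -> entails b c -> entails a c.
Proof.
move=> ab bc; apply/derives_set0/derives_imp/(derives_entails bc).
by apply: derives_entails ab _; apply: derives_ax; right.
Qed.

Definition directed T (R : T -> T -> Prop) (X : set T) :=
  X !=set0 /\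
  forall x y, X x -> X y -> exists z, [/\ X z, R x z & R y z].

Lemma directed1 T (R : T -> T -> Prop) x : R x x -> directed R [set x].
Proof. by move=> Rxx; split=> [|_ _ -> ->]; exists x. Qed.

Lemma directed_image T U (R : T -> T -> Prop) (R' : U -> U -> Prop)
    (h : T -> U) X :
  {homo h : x y / R x y >-> R' x y} -> directed R X -> directed R' (h @` X).
Proof.
move=> hR [[x0 Xx0] dirX]; split; first by exists (h x0), x0.
move=> _ _ [x Xx <-] [y Xy <-]; have [z [Xz xz yz]] := dirX _ _ Xx Xy.
by exists (h z); split; [exists z | exact: hR | exact: hR].
Qed.

Lemma derives_bigcup I (D : set I) (A : I -> set form) a :
  directed (fun i j => A i `<=` A j) D ->
  derives (\bigcup_(i in D) A i) a -> exists2 i, D i & derives (A i) a.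
Proof.
move=> [[i0 Di0] dirD].
elim=> {a} [a ta|a [i Di Aia]|a b _ [i Di ab] _ [j Dj da]].
- by exists i0 => //; exact: derives_thm.
- by exists i => //; exact: derives_ax.
- have [k [Dk ik jk]] := dirD _ _ Di Dj; exists k => //.
  exact: derives_mp (derives_mono ik ab) (derives_mono jk da).
Qed.

Lemma derives_setU_directed (G X : set form) a :
  directed (transp _ entails) X -> derives (G `|` X) a ->
  exists2 x, X x & derives G (Imp x a).
Proof.
move=> [[x0 Xx0] dirX] da.
have [x Xx dxa] : exists2 x, X x & derives (G `|` entails x) a.
  apply: derives_bigcup; last first.
    apply: derives_mono da => b [Gb|Xb]; first by exists x0 => //; left.
    by exists b => //; right; exact: entails_refl.
  split=> [|x y Xx Xy]; first by exists x0.
  have [z [Xz zx zy]] := dirX _ _ Xx Xy.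
  by exists z; split=> //; apply: setUS => b; exact: entails_trans.
exists x => //; apply: derives_imp; apply: derives_cut dxa => b [Gb|xb].
- by apply: derives_ax; left.
- by apply: derives_entails xb _; apply: derives_ax; right.
Qed.

(** * Prime theories *)

Record theory := Theory {
  mem_theory :> form -> Prop;
  theory_derives : forall a, derives mem_theory a -> mem_theory a;
  theory_consistent : ~ mem_theory Bot;
  theory_prime : forall a b,
    mem_theory (Or a b) -> mem_theory a \/ mem_theory b }.

Definition avoids (G D : set form) := forall d, D d -> ~ derives G d.

Lemma derives_setU_bigcup_chain (G : set form) (F : set (set form)) a :
  total_on F subset -> derives (G `|` \bigcup_(X in F) X) a ->
  exists2 X, (set0 |` F) X & derives (G `|` X) a.
Proof.
move=> totF da; apply: derives_bigcup; last first.
  apply: derives_mono da => b [Gb|[X FX Xb]].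
    by exists set0; left.
  by exists X; right.
split=> [|X Y FX FY]; first by exists set0; left.
have [XY|YX] : X `<=` Y \/ Y `<=` X.
- case: FX FY => [->|FX] [->|FY]; last exact: totF.
  + by left.
  + by left; exact: sub0set.
  + by right; exact: sub0set.
- by exists Y; split=> //; exact: setUS.
- by exists X; split=> //; exact: setUS.
Qed.

Lemma maximal_avoiding (G D : set form) : avoids G D ->
  exists T, [/\ G `<=` T, avoids T D &
    forall a, ~ T a -> exists2 d, D d & derives (T `|` [set a]) d].
Proof.
pose P := [set A | avoids (G `|` A) D].
move=> GD; have [|A [AD maxA]] := @Zorn_bigcup form P.
  move=> F FD totF d Dd /(derives_setU_bigcup_chain totF)[X [->|FX]].
  - by rewrite setU0; exact: GD.
  - exact: (FD _ FX).
exists (G `|` A); split=> // a nTa; apply: contrapT => no_d.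
apply: (maxA (A `|` [set a])) => [|d Dd]; last first.
  by rewrite setUA => dd; apply: no_d; exists d.
split=> [x Ax|sub]; first by left.
by apply: nTa; right; apply: sub; right.
Qed.

(** Avoiding a directed set rather than a single formula is what provides
    accessible worlds: there [D] is [{d | ◇d ∉ w}] or [{□c | c ∉ v}]. *)
Lemma lindenbaum (G D : set form) : directed entails D -> avoids G D ->
  exists2 w : theory, G `<=` w & D `<=` ~` w.
Proof.
move=> [[d0 Dd0] dirD] /maximal_avoiding[T [GT TD maxT]].
have Tclosed a : derives T a -> T a.
  move=> da; apply: contrapT => /maxT[d Dd] /derives_imp ad.
  exact: TD Dd (derives_mp ad da).
have Tconsistent : ~ T Bot.
  move=> /derives_ax TB.
  exact: TD Dd0 (derives_entails (bot_entails d0) TB).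
have Tprime a b : T (Or a b) -> T a \/ T b.
  move=> /derives_ax Tab.
  apply: contrapT => /not_orP[/maxT[d Dd ad] /maxT[e De be]].
  have [c [Dc dc ec]] := dirD _ _ Dd De; apply: (TD c Dc).
  exact: derives_or_elim Tab (derives_entails dc ad) (derives_entails ec be).
by exists (Theory Tclosed Tconsistent Tprime) => // d Dd /derives_ax; exact: TD.
Qed.

Section TheoryClosure.

Variable w : theory.

Lemma theory_thm a : GS4 a -> w a.
Proof. by move=> ta; apply/theory_derives/derives_thm. Qed.

Lemma theory_mp a b : w (Imp a b) -> w a -> w b.
Proof.
by move=> ab wa; apply/theory_derives/derives_mp; apply: derives_ax;
  first exact: ab.
Qed.

Lemma theory_entails a b : entails a b -> w a -> w b.
Proof. by move=> /theory_thm; exact: theory_mp. Qed.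

Lemma theory_and a b : w (And a b) <-> w a /\ w b.
Proof.
split=> [wab|[wa wb]].
- by split; apply: theory_entails wab;
    [exact: and_entails_l | exact: and_entails_r].
- by apply: theory_mp wb; apply: theory_entails wa; exact: entails_and_intro.
Qed.

Lemma theory_or a b : w (Or a b) <-> w a \/ w b.
Proof.
split=> [/theory_prime //|[]]; apply: theory_entails.
- exact: entails_or_l.
- exact: entails_or_r.
Qed.

Lemma theory_directed : directed (transp _ entails) w.
Proof.
split; first by exists (Imp Bot Bot); exact/theory_thm/bot_entails.
move=> a b wa wb; exists (And a b).
by split; [exact/theory_and | exact: and_entails_l | exact: and_entails_r].
Qed.

Lemma theory_compl_directed : directed entails (~` w).
Proof.
split; first by exists Bot; exact: theory_consistent.
move=> a b wa wb; exists (Or a b).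
by split; [move=> /theory_or[] | exact: entails_or_l | exact: entails_or_r].
Qed.

Lemma compl_dia_directed : directed entails [set a | ~ w (Dia a)].
Proof.
split.
  exists Bot => wB; apply: (@theory_consistent w).
  exact: theory_entails GS4_N wB.
move=> a b wa wb; exists (Or a b).
split; [|exact: entails_or_l|exact: entails_or_r].
by move=> /(theory_entails (GS4_DP a b))/theory_or[].
Qed.

Definition unbox : set form := [set a | w (Box a)].

Lemma derives_unbox a : derives unbox a -> w (Box a).
Proof.
elim=> {a} [a ta|//|a b _ wab _ wa].
- exact/theory_thm/GS4_Nec.
- by apply: theory_mp wa; apply: theory_entails wab; exact: GS4_K.
Qed.

End TheoryClosure.

Lemma theory_linear (w u v : theory) :
  w `<=` u -> w `<=` v -> u `<=` v \/ v `<=` u.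
Proof.
move=> wu wv; apply: contrapT => /not_orP[].
move=> /existsNP[a /not_implyP[ua nva]] /existsNP[b /not_implyP[vb nub]].
have /theory_or[/wu ab|/wv ba] := theory_thm w (GS4_GD a b).
- exact: nub (theory_mp ab ua).
- exact: nva (theory_mp ba vb).
Qed.

(** * The canonical model *)

Definition accessible (w v : theory) :=
  (forall a, w (Box a) -> v a) /\ (forall a, v a -> w (Dia a)).

Lemma accessible_preorder : is_preorder accessible.
Proof.
split=> [w|u v w [uv vu] [vw wv]]; split=> a.
- exact/theory_entails/GS4_T.
- exact/theory_entails/GS4_Tdia.
- by move=> /(theory_entails (GS4_4 a))/uv/vw.
- by move=> /wv/vu/(theory_entails (GS4_4dia a)).
Qed.

Lemma imp_witness (w : theory) a b : ~ w (Imp a b) ->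
  exists v : theory, [/\ w `<=` v, v a & ~ v b].
Proof.
move=> nab.
have dirb := directed1 (entails_refl b).
have [|v sub avoid] := @lindenbaum (w `|` [set a]) _ dirb.
  by move=> _ -> /derives_imp/theory_derives.
exists v; split; last exact: avoid.
- by move=> c wc; apply: sub; left.
- by apply: sub; right.
Qed.

Lemma accessible_of_dia (w : theory) (X : set form) :
  directed (transp _ entails) X -> (forall x, X x -> w (Dia x)) ->
  exists2 v : theory, X `<=` v & accessible w v.
Proof.
move=> dirX Xdia.
have [|v sub avoid] := @lindenbaum (unbox w `|` X) _ (compl_dia_directed w).
  move=> d /= nd /(derives_setU_directed dirX)[x Xx /derives_unbox wxd].
  apply: nd; apply: theory_mp (Xdia _ Xx).
  exact: theory_entails (GS4_Kdia x d) wxd.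
exists v; first by move=> x Xx; apply: sub; right.
split=> a.
- by move=> wa; apply: sub; left.
- by move=> va; apply: contrapT => nwa; exact: avoid nwa va.
Qed.

Lemma accessible_of_unbox (w v : theory) : unbox w `<=` v ->
  exists2 u : theory, w `<=` u & accessible u v.
Proof.
move=> wv.
have dirX : directed (transp _ entails) (Dia @` v).
  by apply: directed_image (theory_directed v) => a b; exact: dia_entails.
have dirD : directed entails (Box @` ~` v).
  by apply: directed_image (theory_compl_directed v) => a b; exact: box_entails.
have [|u sub avoid] := @lindenbaum (w `|` Dia @` v) _ dirD.
  move=> _ [c nvc <-] /(derives_setU_directed dirX)[_ [b vb <-]].
  move=> /theory_derives wbc; apply: nvc; apply: theory_mp vb; apply: wv.
  exact: theory_entails (GS4_FS b c) wbc.
exists u; first by move=> a wa; apply: sub; left.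
split=> a.
- by move=> ua; apply: contrapT => nva; apply: avoid ua; exists a.
- by move=> va; apply: sub; right; exists a.
Qed.

Lemma dia_witness (w : theory) a : w (Dia a) ->
  exists2 v : theory, accessible w v & v a.
Proof.
move=> wa.
have [| _ ->|v sub wv] // := @accessible_of_dia w [set a].
  by apply: directed1; exact: entails_refl.
by exists v => //; exact: sub.
Qed.

Lemma box_witness (w : theory) a : ~ w (Box a) ->
  exists u v : theory, [/\ w `<=` u, accessible u v & ~ v a].
Proof.
move=> nwa.
have [|v sub avoid] := @lindenbaum (unbox w) _ (directed1 (entails_refl a)).
  by move=> _ -> /derives_unbox.
have [u wu uv] := accessible_of_unbox sub.
by exists u, v; split=> //; exact: avoid.
Qed.

Definition canonical_model : model theory :=
  Model (fun _ => False) (fun w v : theory => w `<=` v) accessible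
    (fun p w => w (Var p)).

Lemma canonical_forward_confluent : forward_confluent canonical_model.
Proof.
move=> w w' v /= ww' [_ vw].
have [|v' vv' wv'] := accessible_of_dia (w := w') (theory_directed v).
  by move=> a /vw/ww'.
by exists v'.
Qed.

Lemma canonical_backward_confluent : backward_confluent canonical_model.
Proof.
move=> w v v' /= [wv _] vv'.
by have [a /wv/vv'//|w' ww' wv'] := @accessible_of_unbox w v'; exists w'.
Qed.

Lemma canonical_GS4_model : GS4_model canonical_model.
Proof.
split; last split; last split; last split.
- split; first by split=> [w|u v w uv vw] //= a /uv/vw.
  split; first exact: accessible_preorder.
  by do 3! [split=> //] => p u v; exact.
- by move=> w [].
- exact: theory_linear.
- exact: canonical_forward_confluent.
- exact: canonical_backward_confluent.
Qed.

Lemma canonical_truth a (w : theory) : sat canonical_model w a <-> w a.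
Proof.
elim: a w => [p| |a IHa b IHb|a IHa b IHb|a IHa b IHb|a IHa|a IHa] w //=.
- by split=> // /theory_consistent.
- by rewrite theory_and IHa IHb.
- by rewrite theory_or IHa IHb.
- split=> [wab|wab v wv /IHa va]; last exact/IHb/(theory_mp (wv _ wab)).
  apply: contrapT => /imp_witness[v [wv va nvb]].
  by apply/nvb/IHb/wab => //; exact/IHa.
- split=> [wa|wa u /(_ _ wa)/dia_witness[v uv va]]; last first.
    by exists v; split=> //; exact/IHa.
  by have [//|v [[_ vw] /IHa/vw]] := wa w.
- split=> [wa|wa u v wu [uv _]]; last exact/IHa/uv/wu.
  apply: contrapT => /box_witness[u [v [wu uv nva]]].
  exact/nva/IHa/(wa u).
Qed.

Lemma canonical_completeness a : model_valid canonical_model a -> GS4 a.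
Proof.
move=> valid; apply: contrapT => na.
have [|w _ nwa] := @lindenbaum set0 _ (directed1 (entails_refl a)).
  by move=> _ -> /derives_set0.
by apply: (nwa a) => //; apply/canonical_truth/valid.
Qed.

(** * Modal formulas along the second relation *)

Section ModalTransfer.

Variables (W : Type) (M : model W).
Hypothesis M_bi_int : bi_int_model M.

Lemma sat_ple w v a : ple M w v -> sat M w a -> sat M v a.
Proof.
have [[_ ple_trans] [_ [bot_ple [_ [val_ple _]]]]] := M_bi_int.
elim: a w v => [p| |a IHa b IHb|a IHa b IHb|a IHa b IHb|a IHa|a IHa] w v wv /=.
- exact: val_ple.
- by move=> /bot_ple; exact.
- by move=> [/(IHa _ _ wv) va /(IHb _ _ wv)].
- by move=> [/(IHa _ _ wv)|/(IHb _ _ wv)]; [left | right].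
- by move=> wab u vu; apply: wab; exact: ple_trans vu.
- by move=> wa u vu; apply: wa; exact: ple_trans vu.
- by move=> wa u t vu; apply: wa; exact: ple_trans vu.
Qed.

Lemma sat_boxE w a : sat M w (Box a) -> sat M w a.
Proof.
have [[ple_refl _] [[sle_refl _] _]] := M_bi_int.
by move=> /(_ w w (ple_refl w) (sle_refl w)).
Qed.

Lemma sat_diaI w a : sat M w a -> sat M w (Dia a).
Proof.
have [_ [[sle_refl _] _]] := M_bi_int.
by move=> wa u wu; exists u; split=> //; exact: sat_ple wa.
Qed.

Lemma sat_box_sle w v a : backward_confluent M ->
  sle M w v -> sat M w (Box a) -> sat M v (Box a).
Proof.
have [_ [[_ sle_trans] _]] := M_bi_int.
move=> backM wv wa u t vu ut; have [w' [ww' w'u]] := backM _ _ _ wv vu.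
exact: wa ww' (sle_trans _ _ _ w'u ut).
Qed.

Lemma sat_dia_sle w v a : forward_confluent M ->
  sle M w v -> sat M v (Dia a) -> sat M w (Dia a).
Proof.
have [_ [[_ sle_trans] _]] := M_bi_int.
move=> forwM wv va u wu; have [v' [vv' uv']] := forwM _ _ _ wu wv.
by have [t [v't ta]] := va _ vv'; exists t; split=> //; exact: sle_trans v't.
Qed.

End ModalTransfer.

(** * Confluence and images of relations *)

Definition confluent W (R S : W -> W -> Prop) :=
  forall w w' v, R w w' -> S w v -> exists v', R v v' /\ S w' v'.

Lemma backward_confluentE W (M : model W) :
  backward_confluent M <-> confluent (ple M) (transp _ (sle M)).
Proof. by split=> conf w v v' wv vv'; exact: conf vv' wv. Qed.

Lemma confluent_clos_rt W (R S : W -> W -> Prop) :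
  confluent R S -> confluent R (clos_refl_trans W S).
Proof.
move=> conf w w' v ww' wv; elim: wv w' ww' => {w v}
  [w v wv|w|w u v _ IHwu _ IHuv] w' ww'.
- have [v' [vv' wv']] := conf _ _ _ ww' wv.
  by exists v'; split=> //; exact: rt_step.
- by exists w'; split=> //; exact: rt_refl.
- have [u' [/IHuv[v' [vv' uv']] wu']] := IHwu _ ww'.
  by exists v'; split=> //; exact: rt_trans uv'.
Qed.

Lemma clos_rt_transp W (R : W -> W -> Prop) :
  clos_refl_trans W (transp _ R) = transp _ (clos_refl_trans W R).
Proof.
apply/funext => x; apply/funext => y; apply/propext.
rewrite /transp; split; elim=> {x y} [x y|x|x y z _ yx _ zy];
  by [exact: rt_step | exact: rt_refl | exact: rt_trans zy yx].
Qed.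

Definition image_rel W W' (f : W -> W') (R : W -> W -> Prop) (c d : W') :=
  exists w v, [/\ f w = c, f v = d & R w v].

Definition kernel_bisim W W' (f : W -> W') (R : W -> W -> Prop) :=
  forall w v w', f w = f v -> R w w' -> exists2 v', R v v' & f v' = f w'.

Lemma image_rel_transp W W' (f : W -> W') (R : W -> W -> Prop) :
  image_rel f (transp _ R) = transp _ (image_rel f R).
Proof.
apply/funext => c; apply/funext => d; apply/propext.
by split=> -[w [v [wc vd wv]]]; exists v, w.
Qed.

Section ImageRelation.

Variables (W W' : Type) (f : W -> W') (R : W -> W -> Prop).
Hypothesis f_bisim : kernel_bisim f R.

Lemma image_relE w d : image_rel f R (f w) d <-> exists2 v, R w v & f v = d.
Proof.
split=> [[w1 [v1 [/f_bisim e <- /e]]]//|[v wv <-]].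
by exists w, v.
Qed.

Lemma confluent_image_rel (S : W -> W -> Prop) :
  confluent R S -> confluent (image_rel f R) (image_rel f S).
Proof.
move=> conf c c' d cc' [w [v [wc <- wv]]].
move: cc'; rewrite -wc => /image_relE[w' ww' <-].
have [v' [vv' wv']] := conf _ _ _ ww' wv.
by exists (f v'); split; [exists v, v' | exists w', v'].
Qed.

End ImageRelation.

(** * Images of models *)

HB.instance Definition _ := gen_eqMixin form.
HB.instance Definition _ := gen_choiceMixin form.

Fixpoint subformulas (a : form) : seq form :=
  a :: match a with
       | Var _ | Bot => [::]
       | And a b | Or a b | Imp a b => subformulas a ++ subformulas b
       | Dia a | Box a => subformulas a
       end.

Lemma forall_cat (T : eqType) (P : T -> Prop) (s t : seq T) :
  {in s ++ t, forall x, P x} <->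
  {in s, forall x, P x} /\ {in t, forall x, P x}.
Proof.
split=> [Pst|[Ps Pt] x]; last by rewrite mem_cat => /orP[/Ps|/Pt].
by split=> x xs; apply: Pst; rewrite mem_cat xs ?orbT.
Qed.

Section ImageModel.

Variables (W W' : Type) (M : model W) (f : W -> W').
Hypothesis M_GS4 : GS4_model M.
Hypothesis f_surj : forall c, exists w, f w = c.
Hypothesis f_bisim : kernel_bisim f (ple M).

Definition image_model : model W' :=
  Model (f @` Wbot M) (image_rel f (ple M))
    (clos_refl_trans W' (image_rel f (sle M))) (fun p => f @` Defs.val M p).

Lemma image_forward_confluent : forward_confluent image_model.
Proof.
have [_ [_ [_ [forwM _]]]] := M_GS4.
exact/confluent_clos_rt/confluent_image_rel.
Qed.

Lemma image_backward_confluent : backward_confluent image_model.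
Proof.
have [_ [_ [_ [_ /backward_confluentE backM]]]] := M_GS4.
apply/backward_confluentE.
rewrite /= -clos_rt_transp -image_rel_transp.
exact/confluent_clos_rt/confluent_image_rel.
Qed.

Lemma image_infallible : infallible image_model.
Proof. by have [_ [inf _]] := M_GS4; move=> c [w /inf]. Qed.

Lemma image_locally_linear : locally_linear image_model.
Proof.
have [_ [_ [lin _]]] := M_GS4.
move=> c d e [w [v [<- <- wv]]] /(image_relE f_bisim)[u wu <-].
by have [vu|uv] := lin _ _ _ wv wu; [left; exists v, u | right; exists u, v].
Qed.

Lemma image_bi_int_model : bi_int_model image_model.
Proof.
have [[[ple_refl ple_trans] [_ [_ [_ [val_ple _]]]]] _] := M_GS4.
split; last split; last split; last split; last split.
- split=> [c|c d e [w [v [<- <- wv]]] /(image_relE f_bisim)[u vu <-]].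
    by have [w <-] := f_surj c; exists w, w; split.
  by exists w, u; split=> //; exact: ple_trans vu.
- by split=> [c|c d e]; [exact: rt_refl | exact: rt_trans].
- by move=> c d /image_infallible.
- by move=> c d /image_infallible.
- move=> p c d cd [w pw wc]; move: cd.
  rewrite -wc => /(image_relE f_bisim)[v wv <-].
  by exists v => //; exact: val_ple pw.
- by move=> p c /image_infallible.
Qed.

Lemma image_GS4_model : GS4_model image_model.
Proof.
split; first exact: image_bi_int_model.
split; first exact: image_infallible.
split; first exact: image_locally_linear.
by split; [exact: image_forward_confluent | exact: image_backward_confluent].
Qed.

Definition respects (a : form) :=
  forall w v, f w = f v -> sat M w a -> sat M v a.

Lemma image_box_transfer w v a : respects (Box a) ->
  sle image_model (f w) (f v) -> sat M w (Box a) -> sat M v (Box a).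
Proof.
have [M_bi_int [_ [_ [_ backM]]]] := M_GS4.
move=> resp wv wa; pose B := f @` [set u | sat M u (Box a)].
suff [u ua /resp] : B (f v) by exact.
have : B (f w) by exists w.
elim: wv => [_ _ [u [t [<- <- ut]]]|//|c d e _ cd _ de /cd/de //].
by move=> [x xa /resp/(_ xa)/(sat_box_sle M_bi_int backM ut)]; exists t.
Qed.

Lemma image_dia_transfer w v a : respects (Dia a) ->
  sle image_model (f w) (f v) -> sat M v (Dia a) -> sat M w (Dia a).
Proof.
have [M_bi_int [_ [_ [forwM _]]]] := M_GS4.
move=> resp wv va; pose D := f @` [set u | sat M u (Dia a)].
suff [u ua /resp] : D (f w) by exact.
have : D (f v) by exists v.
elim: wv => [_ _ [u [t [<- <- ut]]]|//|c d e _ cd _ de /de/cd //].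
by move=> [x xa /resp/(_ xa)/(sat_dia_sle M_bi_int forwM ut)]; exists u.
Qed.

Lemma image_truth a : {in subformulas a, forall b, respects b} ->
  forall w, sat image_model (f w) a <-> sat M w a.
Proof.
have [M_bi_int _] := M_GS4; have [[ple_refl _] _] := M_bi_int.
have image_pleE := image_relE f_bisim.
elim: a => [p| |a IHa b IHb|a IHa b IHb|a IHa b IHb|a IHa|a IHa]
  /= /forall_cons[resp].
- by move=> _ w; split=> [[v vp /resp]|wp]; [exact | exists w].
- by move=> _ w; split=> [[v vB /resp]|wB]; [exact | exists w].
- by move=> /forall_cat[/IHa{}IHa /IHb{}IHb] w; rewrite IHa IHb.
- by move=> /forall_cat[/IHa{}IHa /IHb{}IHb] w; rewrite IHa IHb.
- move=> /forall_cat[/IHa{}IHa /IHb{}IHb] w.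
  split=> [wab v wv /IHa va|wab _ /image_pleE[v wv <-] /IHa va].
    by apply/IHb/wab => //; apply/image_pleE; exists v.
  exact/IHb/wab.
- move=> /IHa{}IHa w; split=> [wa|wa _ /image_pleE[u wu <-]].
    have [|d [wd]] := wa (f w); first by apply/image_pleE; exists w.
    have [v vd] := f_surj d; rewrite -vd in wd * => /IHa/(sat_diaI M_bi_int).
    exact: image_dia_transfer.
  have [v [uv va]] := wa _ wu.
  by exists (f v); split; [apply: rt_step; exists u, v | exact/IHa].
- move=> /IHa{}IHa w.
  split=> [wa u v wu uv|wa _ d /image_pleE[u wu <-]].
    apply/IHa/(wa (f u)); first by apply/image_pleE; exists u.
    by apply: rt_step; exists u, v.
  have [v <-] := f_surj d => uv; apply/IHa/(sat_boxE M_bi_int).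
  exact: image_box_transfer uv (sat_ple M_bi_int (a := Box a) wu wa).
Qed.

End ImageModel.

(** * Chains of traces *)

Section TraceChain.

Variables (W : Type) (M : model W) (S : seq form).
Hypothesis M_bi_int : bi_int_model M.

Definition trace (w : W) : {set seq_sub S} :=
  [set a : seq_sub S | `[< sat M w (val a) >]]%SET.

Definition trace_chain (w : W) : {set {set seq_sub S}} :=
  [set t : {set seq_sub S} | `[< (trace @` ple M w) t >]]%SET.

Lemma trace_mono w v : ple M w v -> trace w \subset trace v.
Proof.
move=> wv; apply/fintype.subsetP => a.
by rewrite !inE; exact: (sat_ple M_bi_int wv).
Qed.

Lemma trace_chainP w t :
  reflect (exists2 v, ple M w v & trace v = t) (t \in trace_chain w).
Proof. by rewrite inE; exact: asboolP. Qed.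

Lemma mem_trace_chain w : trace w \in trace_chain w.
Proof. by have [[ple_refl _] _] := M_bi_int; apply/trace_chainP; exists w. Qed.

Lemma trace_chain_respects a : a \in S -> respects M trace_chain a.
Proof.
move=> aS w v wv wa.
have : trace v \in trace_chain w by rewrite wv mem_trace_chain.
move=> /trace_chainP[u /trace_mono/fintype.subsetP wu uv].
have : SeqSub aS \in trace v.
  by rewrite -uv; apply: wu; rewrite inE; exact/asboolP.
by rewrite inE => /asboolP.
Qed.

Hypothesis M_linear : locally_linear M.

Lemma trace_chain_final w v : ple M w v ->
  trace_chain v = [set t in trace_chain w | trace v \subset t]%SET.
Proof.
move=> wv; have [[_ ple_trans] _] := M_bi_int.
apply/setP => t; rewrite [RHS]inE; apply/idP/andP.
- move=> /trace_chainP[u vu <-]; split; last exact: trace_mono.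
  by apply/trace_chainP; exists u => //; exact: ple_trans vu.
- move=> [/trace_chainP[u wu <-] vu].
  have [sub|/trace_mono uv] := M_linear wv wu.
    by apply/trace_chainP; exists u.
  suff -> : trace u = trace v by exact: mem_trace_chain.
  by apply/eqP; rewrite finset.eqEsubset uv.
Qed.

Lemma trace_chain_bisim : kernel_bisim trace_chain (ple M).
Proof.
move=> w v w' wv ww'.
have : trace w' \in trace_chain v by rewrite -wv; apply/trace_chainP; exists w'.
move=> /trace_chainP[v' vv' tv']; exists v' => //.
by rewrite (trace_chain_final vv') (trace_chain_final ww') wv tv'.
Qed.

End TraceChain.

Section Range.

Variables (W : Type) (F : finType) (f : W -> F).

Definition range_type := {c : F | `[< range f c >]}.

Definition to_range (w : W) : range_type :=
  exist _ (f w) (asboolT (imageT f w)).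

Lemma to_range_eq w v : to_range w = to_range v <-> f w = f v.
Proof. by split=> [[]|wv]; last exact/val_inj. Qed.

Lemma to_range_surj c : exists w, to_range w = c.
Proof.
by case: c => c cP; have /asboolP[w _ wc] := cP; exists w; exact/val_inj.
Qed.

End Range.

Lemma GS4_finite_image W (M : model W) (phi : form) : GS4_model M ->
  exists (W' : finType) (M' : model W') (f : W -> W'),
    GS4_model M' /\ forall w, sat M' (f w) phi <-> sat M w phi.
Proof.
move=> M_GS4; have [M_bi_int [_ [M_linear _]]] := M_GS4.
pose g := trace_chain M (subformulas phi).
have surj := @to_range_surj _ _ g.
have bisim : kernel_bisim (to_range g) (ple M).
  move=> w v w' /to_range_eq wv ww'.
  have [v' vv' v'w'] := trace_chain_bisim M_bi_int M_linear wv ww'.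
  by exists v' => //; exact/to_range_eq.
exists (range_type g : finType), (image_model M (to_range g)), (to_range g).
split; first exact: image_GS4_model.
apply: image_truth => // a a_sub w v /to_range_eq.
exact: trace_chain_respects a_sub w v.
Qed.

Theorem mainTheorem2 (phi : form) :
  ~ GS4 phi ->
  exists (W : finType) (M : model W), GS4_model M /\ ~ model_valid M phi.
Proof.
move=> nphi.
have [W [M [f [M_GS4 f_truth]]]] := GS4_finite_image phi canonical_GS4_model.
exists W, M; split=> // valid; apply: nphi.
apply: canonical_completeness => w _; apply/f_truth/valid.
by have [_ [M_infallible _]] := M_GS4; exact: M_infallible.
Qed.
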